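(* Let $m$ be an odd integer with $m \geq 5$. Then the complete symmetric digraph $K^*_{2m}$ admits a $\vec{C}_m$-factorization, i.e. a resolvable decomposition into directed cycles of length $m$.
   Context: $K^*_n$ denotes the complete symmetric digraph on $n$ vertices: for any two distinct vertices $u,v$ both arcs $(u,v)$ and $(v,u)$ are present, and there are no loops. $\vec{C}_m$ denotes a directed cycle of length $m$. A $\vec{C}_m$-factor of a digraph $G$ is a spanning subdigraph of $G$ that is a disjoint union of directed $m$-cycles. A $\vec{C}_m$-factorization of $G$ is a partition of the arc set of $G$ into (arc sets of) $\vec{C}_m$-factors of $G$; equivalently a resolvable decomposition of $G$ into directed $m$-cycles. *)

(* Defs.v *)
From mathcomp Require Import all_boot.
Set Implicit Arguments. Unset Strict Implicit. Unset Printing Implicit Defensive.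

(* Vertex set of K*_n is 'I_n.  A directed cycle of length m is represented by the
   cyclic sequence of its m distinct vertices [:: c_0; ...; c_(m-1)];
   its arcs are (c_i, c_(i+1 mod m)). *)
Definition dcycle_arcs (T : eqType) (c : seq T) : seq (T * T) := zip c (rot 1 c).

Definition is_dcycle (T : eqType) (m : nat) (c : seq T) : bool :=
  (size c == m) && uniq c.

Definition Kstar_arcs (n : nat) : seq ('I_n * 'I_n) :=
  [seq uv <- enum {: 'I_n * 'I_n} | uv.1 != uv.2].

Definition is_Cm_factor (n m : nat) (F : seq (seq 'I_n)) : bool :=
  all (is_dcycle m) F && perm_eq (flatten F) (enum 'I_n).

Definition is_Cm_factorization (n m : nat) (FF : seq (seq (seq 'I_n))) : bool :=
  all (is_Cm_factor m) FF &&
  perm_eq (flatten (map (@dcycle_arcs _) (flatten FF))) (Kstar_arcs n).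

(* Main.v *)
From HB Require Import structures.
Require Import Defs.
From mathcomp Require Import all_boot.
From mathcomp Require Import zify.
Set Implicit Arguments. Unset Strict Implicit. Unset Printing Implicit Defensive.

(** Put m = 2k+1 and take the vertices to be Z_4k together with two points A and B.
    The zigzag A, 0, 1, -1, 2, -2, .., k is a directed m-cycle, and so is its mirror
    image B, 2k+1, 2k, 2k+2, 2k-1, .., k+1 under x |-> 2k+1-x; together they form a
    factor F which uses every nonzero difference except 2k exactly once.  Hence the 4k
    rotations of F are disjoint factors whose union misses only the arcs x <-> x+2k and
    A <-> B.  It remains to redistribute the arcs of a few rotations F_r, r in R, and
    the missed arcs into |R|+1 factors (a "block").

    For k >= 8 we use R = {0, 1, 2k, -1}.  Grouping j, 1-j, j+2k, 1-j+2k into the j-th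
    of k consecutive levels, the arcs of these four rotations and the missed arcs join
    nearby levels only, and A, B are attached to the first and last levels.  A block for
    k = 8 or k = 9, found by computer, has a middle part that is periodic of period two
    levels and in which both cycles of each factor gain the same number of vertices per
    period, so that inserting t periods yields a block for k + 2t.  For 2 <= k <= 7
    blocks are given explicitly. *)

(** * Arcs of families of cycles *)

Definition arcs_of (T : eqType) (FF : seq (seq (seq T))) : seq (T * T) :=
  flatten (map (@dcycle_arcs T) (flatten FF)).

Lemma size_dcycle_arcs (T : eqType) (c : seq T) : size (dcycle_arcs c) = size c.
Proof. by rewrite size1_zip // size_rot. Qed.

Lemma dcycle_arcs_map (T U : eqType) (f : T -> U) (c : seq T) :
  dcycle_arcs (map f c) = [seq (f e.1, f e.2) | e <- dcycle_arcs c].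
Proof.
rewrite /dcycle_arcs -map_rot; move: (rot 1 c) => d.
by elim: c d => [|x c IH] [|y d] //=; rewrite IH.
Qed.

Lemma arcs_of_map (T U : eqType) (f : T -> U) (FF : seq (seq (seq T))) :
  arcs_of (map (map (map f)) FF) = [seq (f e.1, f e.2) | e <- arcs_of FF].
Proof.
rewrite /arcs_of -[flatten (map (map (map f)) FF)]map_flatten.
rewrite [RHS]map_flatten -!map_comp; congr flatten.
by apply: eq_map => c /=; rewrite dcycle_arcs_map.
Qed.

Lemma mem_arcs_of (T : eqType) (FF : seq (seq (seq T))) (e : T * T) :
  reflect (exists F c, [/\ F \in FF, c \in F & e \in dcycle_arcs c])
          (e \in arcs_of FF).
Proof.
apply: (iffP flatten_mapP) => [[c /flattenP[F FF_F Fc] ce]|[F [c [FF_F Fc ce]]]].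
  by exists F, c.
by exists c => //; apply/flattenP; exists F.
Qed.

Lemma uniq_flatten_mem (T : eqType) (ss : seq (seq T)) c :
  uniq (flatten ss) -> c \in ss -> uniq c.
Proof.
elim: ss => [|d ss IH] //=; rewrite cat_uniq inE => /and3P[ud _ uss] /predU1P[-> //|].
exact: IH.
Qed.

(** * Factorizations by counting, with natural numbers as vertices *)

Lemma size_Kstar_arcs n : size (Kstar_arcs n) = n * n.-1.
Proof.
rewrite /Kstar_arcs size_filter.
have := count_predC (fun uv : 'I_n * 'I_n => uv.1 != uv.2) (enum {: 'I_n * 'I_n}).
rewrite -cardE card_prod card_ord.
have -> : count (predC (fun uv : 'I_n * 'I_n => uv.1 != uv.2))
            (enum {: 'I_n * 'I_n}) = n.
  rewrite -size_filter -[RHS]size_enum_ord.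
  rewrite -(size_map (fun x : 'I_n => (x, x)) (enum 'I_n)).
  apply: perm_size; apply: uniq_perm.
  - by rewrite filter_uniq // enum_uniq.
  - by rewrite map_inj_uniq ?enum_uniq // => x y [].
  move=> [x y]; rewrite mem_filter mem_enum inE andbT /= negbK.
  apply/eqP/mapP => [->|[z _ [-> ->]] //]; by exists y => //; rewrite mem_enum.
by rewrite -subn1 mulnBr muln1 => <-; rewrite addnK.
Qed.

(** Vertices are plain numbers until the end, which suits [lia] and computation. Distinctness within
    a cycle follows from the permutation of [iota 0 n]. *)
Definition is_nat_factor (n m : nat) (F : seq (seq nat)) : bool :=
  all (fun c => size c == m) F && perm_eq (flatten F) (iota 0 n).

Lemma sumn_const_map (T : eqType) (f : T -> nat) (s : seq T) (n : nat) :
  {in s, forall x, f x = n} -> sumn (map f s) = size s * n.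
Proof.
elim: s => [|x s IH] //= fE; rewrite fE ?mem_head // IH ?mulSn // => y ys.
by rewrite fE // inE ys orbT.
Qed.

Lemma size_arcs_of (T : eqType) (FF : seq (seq (seq T))) (n : nat) :
  {in FF, forall F, size (flatten F) = n} -> size (arcs_of FF) = size FF * n.
Proof.
move=> FFn; rewrite /arcs_of size_flatten /shape -map_comp.
under eq_map => c do rewrite /= size_dcycle_arcs.
rewrite -[map _ _]/(shape (flatten FF)) -size_flatten.
elim: FF FFn => [|F FF IH] //= FFn.
rewrite flatten_cat size_cat FFn ?mem_head // IH ?mulSn // => G GF.
by rewrite FFn // inE GF orbT.
Qed.

(** Counting makes covering enough: n - 1 factors of n arcs each have as many arcs as
    [Kstar_arcs n], so if every arc occurs, none occurs twice. Arc-disjointness is thus never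
    checked directly. *)
Lemma factorization_of_nat (n m : nat) (FF : seq (seq (seq nat))) :
  0 < n -> all (is_nat_factor n m) FF -> size FF = n.-1 ->
  (forall u v, u < n -> v < n -> u != v -> (u, v) \in arcs_of FF) ->
  exists FF' : seq (seq (seq 'I_n)), is_Cm_factorization m FF'.
Proof.
case: n => [//|n] _ /allP FFok szFF cov.
pose g : nat -> 'I_n.+1 := inord.
have g_iota : map g (iota 0 n.+1) = enum 'I_n.+1.
  by rewrite -val_enum_ord -map_comp -[RHS]map_id; apply: eq_map => i; apply: inord_val.
exists (map (map (map g)) FF); apply/andP; split.
  apply/allP => _ /mapP[F FF_F ->].
  have /andP[/allP szF permF] := FFok _ FF_F.
  have permgF : perm_eq (flatten (map (map g) F)) (enum 'I_n.+1).
    by rewrite -map_flatten -g_iota; apply: perm_map.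
  apply/andP; split=> //.
  apply/allP => d dF; rewrite /is_dcycle.
  rewrite (uniq_flatten_mem _ dF) ?andbT; last by rewrite (perm_uniq permgF) enum_uniq.
  by case/mapP: dF => c Fc ->; rewrite size_map szF.
rewrite -/(arcs_of (map (map (map g)) FF)) perm_sym.
have uK : uniq (Kstar_arcs n.+1) by rewrite filter_uniq // enum_uniq.
have subK : {subset Kstar_arcs n.+1 <= arcs_of (map (map (map g)) FF)}.
  move=> [u v]; rewrite mem_filter /= => /andP[uv _]; rewrite arcs_of_map.
  apply/mapP; exists (val u, val v); last by rewrite /= /g !inord_val.
  exact: cov (ltn_ord u) (ltn_ord v) uv.
have szK : size (arcs_of (map (map (map g)) FF)) <= size (Kstar_arcs n.+1).
  rewrite (@size_arcs_of _ _ n.+1) ?size_map ?szFF ?size_Kstar_arcs 1?mulnC //.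
  move=> _ /mapP[F FF_F ->]; have /andP[_ permF] := FFok _ FF_F.
  by rewrite -map_flatten size_map (perm_size permF) size_iota.
apply: uniq_perm => //; first exact: leq_size_uniq uK subK szK.
by case: (uniq_min_size uK subK szK).
Qed.

(** * Zigzag factors and their rotations *)

(* The j-th level occupies the codes 4j, .., 4j+3, standing for the residues j, 1-j,
   j+2k, 1-j+2k modulo 4k; the codes 2 and 3 stand for A and B, whose values are 4k
   and 4k+1. *)
Definition band_val (k v : nat) : nat :=
  if v < 4 then 4 * k + v - 2 else
  let j := v %/ 4 in
  match v %% 4 with
  | 0 => j
  | 1 => if j == 1 then 0 else 4 * k + 1 - j
  | 2 => j + 2 * k
  | _ => 2 * k + 1 - j
  end.

(** The rotation x -> x + r of Z_4k, fixing A = 4k and B = 4k+1; for r < 4k a single subtraction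
    reduces the sum. *)
Definition rot_val (k r x : nat) : nat :=
  if x < 4 * k then (if x + r < 4 * k then x + r else x + r - 4 * k) else x.

Lemma band_val_lane k j t : 0 < j -> t < 4 ->
  band_val k (4 * j + t) =
  match t with
  | 0 => j
  | 1 => if j == 1 then 0 else 4 * k + 1 - j
  | 2 => j + 2 * k
  | _ => 2 * k + 1 - j
  end.
Proof.
move=> j0 t4; rewrite /band_val.
have -> : (4 * j + t < 4) = false by lia.
have -> : (4 * j + t) %/ 4 = j by lia.
by have -> : (4 * j + t) %% 4 = t by lia.
Qed.

Lemma band_val0 k j : 0 < j -> band_val k (4 * j) = j.
Proof. by move=> j0; rewrite -[4 * j]addn0 band_val_lane. Qed.

Lemma band_val1 k j : 0 < j ->
  band_val k (4 * j + 1) = if j == 1 then 0 else 4 * k + 1 - j.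
Proof. by move=> j0; rewrite band_val_lane. Qed.

Lemma band_val2 k j : 0 < j -> band_val k (4 * j + 2) = j + 2 * k.
Proof. by move=> j0; rewrite band_val_lane. Qed.

Lemma band_val3 k j : 0 < j -> band_val k (4 * j + 3) = 2 * k + 1 - j.
Proof. by move=> j0; rewrite band_val_lane. Qed.

Lemma band_valA k : band_val k 2 = 4 * k.
Proof. by rewrite /band_val /=; lia. Qed.

Lemma band_valB k : band_val k 3 = 4 * k + 1.
Proof. by rewrite /band_val /=; lia. Qed.

(** Case analysis in this form gives expressions linear in the level j, without the division in
    [band_val]. *)
Variant band_spec (k : nat) : nat -> nat -> Prop :=
  | BandA : band_spec k 2 (4 * k)
  | BandB : band_spec k 3 (4 * k + 1)
  | Band0 j of 0 < j <= k : band_spec k (4 * j) j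
  | Band1 j of 0 < j <= k : band_spec k (4 * j + 1) (if j == 1 then 0 else 4 * k + 1 - j)
  | Band2 j of 0 < j <= k : band_spec k (4 * j + 2) (j + 2 * k)
  | Band3 j of 0 < j <= k : band_spec k (4 * j + 3) (2 * k + 1 - j).

Lemma bandP k v : 1 < v < 4 * k + 4 -> band_spec k v (band_val k v).
Proof.
move=> /andP[v1 vk].
have [v4|v4] := ltnP v 4.
  have [->|->] : v = 2 \/ v = 3 by lia.
    by rewrite band_valA; constructor.
  by rewrite band_valB; constructor.
have vE := divn_eq v 4; rewrite mulnC in vE; rewrite vE.
have jk : 0 < v %/ 4 <= k by lia.
have j0 : 0 < v %/ 4 by lia.
have := ltn_pmod v (isT : 0 < 4).
case: (v %% 4) => [|[|[|[|//]]]] _.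
- by rewrite addn0 band_val0 //; constructor.
- by rewrite band_val1 //; constructor.
- by rewrite band_val2 //; constructor.
- by rewrite band_val3 //; constructor.
Qed.

Lemma band_val_lt k v : 1 < v < 4 * k + 4 -> band_val k v < 4 * k + 2.
Proof. by move/bandP; case: (band_val k v) / => *; try case: ifP => ?; lia. Qed.

(** The lanes fill disjoint sets of residues: lane 0 has 1..k, lane 3 has k+1..2k, lane 2 has
    2k+1..3k, lane 1 has 3k+1..4k-1 and 0. *)
Lemma band_val_inj k :
  {in [pred v | 1 < v < 4 * k + 4] &, injective (band_val k)}.
Proof.
move=> u v; rewrite !inE => /bandP + /bandP.
by case: (band_val k u) / => [||i ?|i ?|i ?|i ?]; case: (band_val k v) / => [||j ?|j ?|j ?|j ?] //;
  repeat case: ifP; lia.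
Qed.

Lemma rot_val_lt k r x : r < 4 * k -> x < 4 * k + 2 -> rot_val k r x < 4 * k + 2.
Proof. by rewrite /rot_val => rk xk; repeat case: ifP; lia. Qed.

Lemma rot_val_inj k r : r < 4 * k -> injective (rot_val k r).
Proof. by move=> rk x y; rewrite /rot_val; repeat case: ifP; lia. Qed.

Lemma rot_val0 k x : rot_val k 0 x = x.
Proof. by rewrite /rot_val; repeat case: ifP; lia. Qed.

(** An injection of the 4k+2 codes into the 4k+2 vertices is a bijection, so a permutation of the
    codes becomes one of the vertices. *)
Lemma band_factor k m r (F : seq (seq nat)) :
  r < 4 * k -> all (fun c => size c == m) F ->
  perm_eq (flatten F) (iota 2 (4 * k + 2)) ->
  is_nat_factor (4 * k + 2) m (map (map (rot_val k r \o band_val k)) F).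
Proof.
move=> rk szF permF; apply/andP; split.
  by apply/allP => _ /mapP[c Fc ->]; rewrite size_map (allP szF).
rewrite -map_flatten.
have /perm_trans-> // := perm_map (rot_val k r \o band_val k) permF.
have uf : uniq (map (rot_val k r \o band_val k) (iota 2 (4 * k + 2))).
  rewrite map_inj_in_uniq ?iota_uniq // => x y.
  rewrite !mem_iota => xk yk /(rot_val_inj rk); apply: band_val_inj; rewrite inE; lia.
have sub : {subset map (rot_val k r \o band_val k) (iota 2 (4 * k + 2))
            <= iota 0 (4 * k + 2)}.
  move=> _ /mapP[x + ->]; rewrite !mem_iota /= => xk.
  by rewrite add0n; apply: rot_val_lt => //; apply: band_val_lt; lia.
apply: uniq_perm; rewrite ?iota_uniq //.
by case: (uniq_min_size uf sub); rewrite ?size_map ?size_iota.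
Qed.

(* The arcs of F, in codes. *)
Variant zig (k : nat) : nat -> nat -> Prop :=
  | Zig10 j of 0 < j <= k : zig k (4 * j + 1) (4 * j)
  | Zig01 j of 0 < j < k : zig k (4 * j) (4 * (j + 1) + 1)
  | Zig23 j of 0 < j <= k : zig k (4 * j + 2) (4 * j + 3)
  | Zig32 j of 0 < j < k : zig k (4 * j + 3) (4 * (j + 1) + 2)
  | Zig0A : zig k (4 * k) 2
  | ZigA1 : zig k 2 5
  | Zig3B : zig k (4 * k + 3) 3
  | ZigB2 : zig k 3 6.

(** The last hypothesis says that y - x and v - u agree modulo 4k, its three cases being all
    possible wraps; the rotation is by u - x. *)
Lemma rot_val_shift k x y u v :
  x < 4 * k -> y < 4 * k -> u < 4 * k -> v < 4 * k ->
  y + u = x + v \/ y + u = x + v + 4 * k \/ y + u + 4 * k = x + v ->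
  exists2 r, r < 4 * k & rot_val k r x = u /\ rot_val k r y = v.
Proof.
move=> xk yk uk vk H; exists (if x <= u then u - x else u + 4 * k - x).
  by case: ifP; lia.
rewrite /rot_val xk yk.
by case: H => [H|[H|H]]; have [xu|xu] := leqP x u; split; case: ifP; lia.
Qed.

(** The arcs used by no rotation of F. *)
Definition matched (k u v : nat) : Prop :=
  (u < 2 * k /\ v = u + 2 * k) \/ (v < 2 * k /\ u = v + 2 * k) \/
  (u = 4 * k /\ v = 4 * k + 1) \/ (u = 4 * k + 1 /\ v = 4 * k).

(** The difference v - u selects the arc of F: [Zig10] realises the odd differences below 2k,
    [Zig32] the even ones below 2k, [Zig01] the even and [Zig23] the odd ones above 2k. At A and B
    the arc of F is determined by its direction, and the rotation by the residue at the other
    end. *)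
Lemma zig_cover k u v : 1 < k -> u < 4 * k + 2 -> v < 4 * k + 2 -> u != v ->
  matched k u v \/
  exists r a b, [/\ r < 4 * k, zig k a b, rot_val k r (band_val k a) = u
                 & rot_val k r (band_val k b) = v].
Proof.
move=> k1 uk vk uv.
have out r x : 4 * k <= x -> rot_val k r x = x by rewrite /rot_val ltnNge => ->.
have fin a b x y : zig k a b -> band_val k a = x -> band_val k b = y ->
    x < 4 * k -> y < 4 * k -> u < 4 * k -> v < 4 * k ->
    y + u = x + v \/ y + u = x + v + 4 * k \/ y + u + 4 * k = x + v ->
    exists r a b, [/\ r < 4 * k, zig k a b, rot_val k r (band_val k a) = u
                   & rot_val k r (band_val k b) = v].
  move=> z ax bx xk yk uk' vk' H.
  have [r rk [ru rv]] := rot_val_shift xk yk uk' vk' H.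
  by exists r, a, b; rewrite ax bx.
have [uF|uI] := ltnP u (4 * k); last first.
  have [vI|vF] := leqP (4 * k) v; first by left; rewrite /matched; lia.
  right; have [uE|uE] : u = 4 * k \/ u = 4 * k + 1 by lia.
    (* A degenerate shift with x = y only asks for a rotation taking one residue to another. Here 0
       is the successor of A in F; below, 2k+1 is that of B, and k and k+1 are the predecessors of A
       and B. *)
    have [|||||r rk [rv _]] := @rot_val_shift k 0 0 v v; try lia.
    exists r, 2, 5; split=> //; first exact: ZigA1.
    by rewrite band_valA out.
  have [|||||r rk [rv _]] := @rot_val_shift k (1 + 2 * k) (1 + 2 * k) v v; try lia.
  exists r, 3, 6; split=> //; first exact: ZigB2.
  by rewrite band_valB out //; lia.
have [vF|vI] := ltnP v (4 * k); last first.
  right; have [vE|vE] : v = 4 * k \/ v = 4 * k + 1 by lia.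
    have [|||||r rk [ru _]] := @rot_val_shift k k k u u; try lia.
    exists r, (4 * k), 2; split=> //; first exact: Zig0A.
      by rewrite band_val0 //; lia.
    by rewrite band_valA out.
  have [|||||r rk [ru _]] := @rot_val_shift k (k + 1) (k + 1) u u; try lia.
  have bE : band_val k (4 * k + 3) = k + 1 by rewrite band_val3; lia.
  exists r, (4 * k + 3), 3; rewrite bE band_valB (out r (4 * k + 1)); last by lia.
  by split=> //; exact: Zig3B.
have [d dE dk] : exists2 d, v = u + d \/ v + 4 * k = u + d & 0 < d < 4 * k.
  have [?|?] := leqP u v; [exists (v - u)|exists (v + 4 * k - u)]; lia.
have [d2k|d2k] := eqVneq d (2 * k); first by left; rewrite /matched; lia.
right.
have [j jE] : exists j, d = 2 * j \/ d = 2 * j + 1 by exists (d %/ 2); lia.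
have [dlt|dgt] := ltnP d (2 * k).
  case: jE => dj.
    apply: (@fin (4 * j + 3) (4 * (j + 1) + 2) (2 * k + 1 - j) (j + 1 + 2 * k)); try lia.
    - by apply: Zig32; lia.
    - by rewrite band_val3 //; lia.
    - by rewrite band_val2 //; lia.
  apply: (@fin (4 * (j + 1) + 1) (4 * (j + 1))
            (if j + 1 == 1 then 0 else 4 * k + 1 - (j + 1)) (j + 1));
    try by [case: ifP; lia|lia].
  - by apply: Zig10; lia.
  - by rewrite band_val1 //; lia.
  - by rewrite band_val0 //; lia.
(* From level i, [Zig01] has difference 4k - 2i and [Zig23] has 4k + 1 - 2i, whence i = 2k - j. *)
case: jE => dj.
  apply: (@fin (4 * (2 * k - j)) (4 * (2 * k - j + 1) + 1)
            (2 * k - j) (4 * k + 1 - (2 * k - j + 1))); try lia.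
  - by apply: Zig01; lia.
  - by rewrite band_val0 //; lia.
  - by rewrite band_val1; last lia; case: ifP; lia.
apply: (@fin (4 * (2 * k - j) + 2) (4 * (2 * k - j) + 3)
          (2 * k - j + 2 * k) (2 * k + 1 - (2 * k - j))); try lia.
- by apply: Zig23; lia.
- by rewrite band_val2 //; lia.
- by rewrite band_val3 //; lia.
Qed.

(** * Periodic cycle templates *)

Definition pairs (T : Type) (s : seq T) : seq (T * T) := zip s (behead s).

Lemma pairs_cat (T : Type) (x : T) s1 s2 :
  pairs (x :: s1 ++ s2) = pairs (x :: s1) ++ pairs (last x s1 :: s2).
Proof. by elim: s1 x => [|y s1 IH] x //=; rewrite /pairs /= in IH *; rewrite IH. Qed.

Lemma pairs_map (T U : Type) (f : T -> U) s :
  pairs (map f s) = [seq (f e.1, f e.2) | e <- pairs s].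
Proof.
by case: s => // x s; elim: s x => [|y s IH] x //=; rewrite /pairs /= in IH *; rewrite IH.
Qed.

Lemma dcycle_arcs_cons (T : eqType) (x : T) s :
  dcycle_arcs (x :: s) = pairs (x :: rcons s x).
Proof.
rewrite /dcycle_arcs /pairs rot1_cons /=.
by elim: s {1 3}x => [|z s IH] y //=; rewrite IH.
Qed.

(* An item of a cycle template: a vertex, which is shifted by t periods if the flag is
   set, or a word repeated t times while moving up or down by one period each time. *)
Variant item := Fix of bool & nat | Up of seq nat | Down of seq nat.

Definition item_code (i : item) : (bool * nat) + (bool * seq nat) :=
  match i with
  | Fix r x => inl (r, x)
  | Up w => inr (true, w)
  | Down w => inr (false, w)
  end.

Definition item_decode (c : (bool * nat) + (bool * seq nat)) : item :=
  match c with
  | inl p => Fix p.1 p.2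
  | inr p => if p.1 then Up p.2 else Down p.2
  end.

Lemma item_codeK : cancel item_code item_decode. Proof. by case. Qed.

HB.instance Definition _ := Equality.copy item (can_type item_codeK).

Section Templates.
(** The length of a period in codes, four per level. *)
Variable q : nat.

Definition shift (d : nat) : seq nat -> seq nat := map (addn d).

Definition at_ (t : nat) (p : bool * nat) : nat := if p.1 then q * t + p.2 else p.2.

Fixpoint up (w : seq nat) (t : nat) : seq nat :=
  if t is t'.+1 then up w t' ++ shift (q * t') w else [::].

Fixpoint down (w : seq nat) (t : nat) : seq nat :=
  if t is t'.+1 then shift (q * t') w ++ down w t' else [::].

Definition ev (t : nat) (i : item) : seq nat :=
  match i with
  | Fix r x => [:: at_ t (r, x)]
  | Up w => up w t
  | Down w => down w t
  end.

Definition evs (t : nat) (c : seq item) : seq nat := flatten (map (ev t) c).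

(** Here p is the vertex preceding c. A run leads from one copy of p, shifted by t periods or not,
    to the other, so it only changes the flag of the predecessor, and t need not appear. *)
Fixpoint fixed_arcs (p : bool * nat) (c : seq item) : seq ((bool * nat) * (bool * nat)) :=
  match c with
  | [::] => [::]
  | Fix r y :: c' => (p, (r, y)) :: fixed_arcs (r, y) c'
  | Up _ :: c' => fixed_arcs (true, p.2) c'
  | Down _ :: c' => fixed_arcs (false, p.2) c'
  end.

(** The arcs of copy number 0 of each word, with the arc entering it; a downward copy is entered
    from one period higher. *)
Fixpoint run_arcs (p : bool * nat) (c : seq item) : seq (nat * nat) :=
  match c with
  | [::] => [::]
  | Fix r y :: c' => run_arcs (r, y) c'
  | Up w :: c' => pairs (p.2 :: w) ++ run_arcs (true, p.2) c'
  | Down w :: c' => pairs (q + p.2 :: w) ++ run_arcs (false, p.2) c'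
  end.

(* A run is inserted after a vertex p, on whose t-th shift it has to end (or begin); the
   item after the run therefore sees the same predecessor for every t, also t = 0. *)
Fixpoint wf (p : bool * nat) (c : seq item) : bool :=
  match c with
  | [::] => true
  | Fix r y :: c' => wf (r, y) c'
  | Up w :: c' => [&& ~~ p.1, last p.2 w == q + p.2 & wf (true, p.2) c']
  | Down w :: c' => [&& p.1, last (q + p.2) w == p.2 & wf (false, p.2) c']
  end.

Lemma last_shift d x w : last (d + x) (shift d w) = d + last x w.
Proof. exact: last_map. Qed.

Lemma last_up x w t : last x w = q + x -> last x (up w t) = q * t + x.
Proof.
move=> wx; elim: t => [|t IH] /=; first by rewrite muln0.
by rewrite last_cat IH last_shift wx mulnS; lia.
Qed.

Lemma last_down x w t : last (q + x) w = x -> last (q * t + x) (down w t) = x.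
Proof.
move=> wx; elim: t => [|t IH] /=; first by rewrite muln0.
by rewrite last_cat mulnS [q + _]addnC -addnA last_shift wx.
Qed.

Definition shift_arc (s : nat) (e : nat * nat) := (q * s + e.1, q * s + e.2).

(** Each copy ends on x shifted by one more period, so copy number s with its entering arc is the
    path x :: w shifted by q s. *)
Lemma up_arcs x w t e s : last x w = q + x -> e \in pairs (x :: w) -> s < t ->
  shift_arc s e \in pairs (x :: up w t).
Proof.
move=> wx ew; elim: t => // t IH; rewrite ltnS leq_eqVlt => /predU1P[->|/IH] /=;
  rewrite pairs_cat mem_cat last_up //; last by move=> ->.
rewrite -[_ :: shift _ _]/(shift (q * t) (x :: w)) pairs_map.
by apply/orP; right; apply/mapP; exists e.
Qed.

Lemma down_arcs x w t e s : last (q + x) w = x -> e \in pairs (q + x :: w) -> s < t ->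
  shift_arc s e \in pairs (q * t + x :: down w t).
Proof.
move=> wx ew; elim: t => // t IH; rewrite ltnS leq_eqVlt => /predU1P[->|/IH] /=;
  rewrite mulnS [q + _]addnC -addnA pairs_cat mem_cat last_shift wx; last by move=> ->; rewrite orbT.
rewrite -[_ :: shift _ _]/(shift (q * t) (q + x :: w)) pairs_map.
by apply/orP; left; apply/mapP; exists e.
Qed.

(** Where a run follows p, the path splits at the last vertex of the run; [last_up] and [last_down]
    identify it as the other copy of p, which is the predecessor assumed by the recursion. *)
Lemma template_arcs t p c : wf p c ->
  {in fixed_arcs p c, forall e, (at_ t e.1, at_ t e.2) \in pairs (at_ t p :: evs t c)} /\
  {in run_arcs p c, forall e s, s < t -> shift_arc s e \in pairs (at_ t p :: evs t c)}.
Proof.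
elim: c p => [|[r y|w|w] c IH] [b x] //=.
- move=> /IH[IHf IHr]; split=> [e|e er s st].
    by rewrite inE => /predU1P[->|/IHf ef]; rewrite /evs /= /pairs /= inE ?eqxx // ef orbT.
  by rewrite /evs /= /pairs /= inE; rewrite [X in _ || X]IHr ?orbT.
- move=> /and3P[/negbTE-> /eqP wx /IH[IHf IHr]].
  rewrite /evs /= pairs_cat last_up //; split=> [e ef|e].
    by rewrite mem_cat [X in _ || X]IHf ?orbT.
  rewrite mem_cat => /orP[ew|er] s st; rewrite mem_cat; last by rewrite [X in _ || X]IHr ?orbT.
  by rewrite up_arcs.
- move=> /and3P[-> /eqP wx /IH[IHf IHr]].
  rewrite /evs /= pairs_cat [at_ t (true, x)]/at_ /= last_down //; split=> [e ef|e].
    by rewrite mem_cat [X in _ || X]IHf ?orbT.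
  rewrite mem_cat => /orP[ew|er] s st; rewrite mem_cat; last by rewrite [X in _ || X]IHr ?orbT.
  by rewrite down_arcs.
Qed.

Fixpoint fixed_verts (c : seq item) : seq (bool * nat) :=
  match c with
  | [::] => [::]
  | Fix r y :: c' => (r, y) :: fixed_verts c'
  | _ :: c' => fixed_verts c'
  end.

Fixpoint run_verts (c : seq item) : seq nat :=
  match c with
  | [::] => [::]
  | Fix _ _ :: c' => run_verts c'
  | Up w :: c' | Down w :: c' => w ++ run_verts c'
  end.

Lemma up_verts w t x s : x \in w -> s < t -> q * s + x \in up w t.
Proof.
move=> xw; elim: t => // t IH; rewrite ltnS leq_eqVlt mem_cat => /predU1P[->|/IH-> //].
by rewrite map_f ?orbT.
Qed.

Lemma down_verts w t x s : x \in w -> s < t -> q * s + x \in down w t.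
Proof.
move=> xw; elim: t => // t IH; rewrite ltnS leq_eqVlt mem_cat => /predU1P[->|/IH->].
  by rewrite map_f.
by rewrite orbT.
Qed.

Lemma template_verts t c :
  {in fixed_verts c, forall p, at_ t p \in evs t c} /\
  {in run_verts c, forall x s, s < t -> q * s + x \in evs t c}.
Proof.
elim: c => [|[r y|w|w] c [IHf IHr]] //=; rewrite /evs /=; split=> x.
- by rewrite !inE => /predU1P[->|/IHf]; rewrite ?eqxx // => ->; rewrite orbT.
- by move=> /IHr xr s /xr; rewrite inE => ->; rewrite orbT.
- by move=> /IHf; rewrite mem_cat => ->; rewrite orbT.
- rewrite mem_cat => /orP[xw|/IHr xr] s; rewrite mem_cat; first by move/up_verts->.
  by move=> /xr; rewrite /evs => ->; rewrite orbT.
- by move=> /IHf; rewrite mem_cat => ->; rewrite orbT.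
- rewrite mem_cat => /orP[xw|/IHr xr] s; rewrite mem_cat; first by move/down_verts->.
  by move=> /xr; rewrite /evs => ->; rewrite orbT.
Qed.

Lemma size_up w t : size (up w t) = size w * t.
Proof. by elim: t => [|t IH] /=; rewrite ?muln0 // size_cat size_map IH mulnS addnC. Qed.

Lemma size_down w t : size (down w t) = size w * t.
Proof. by elim: t => [|t IH] /=; rewrite ?muln0 // size_cat size_map IH mulnS. Qed.

Lemma size_evs t c : size (evs t c) = size (fixed_verts c) + size (run_verts c) * t.
Proof.
by elim: c => [|[r y|w|w] c IH] //=; rewrite /evs /= in IH *;
  rewrite ?size_cat ?IH ?size_up ?size_down; lia.
Qed.

(* The arcs e + q s with s < n0 + t are cut at some s1: those before it are fixed on the
   left, the t following ones come from runs, the others are shifted by t periods. *)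
Definition family_ok (fx : seq ((bool * nat) * (bool * nat))) (rn : seq (nat * nat))
    (e : nat * nat) (n0 : nat) : bool :=
  has (fun s1 =>
    [&& shift_arc s1 e \in rn,
        all (fun s => ((false, q * s + e.1), (false, q * s + e.2)) \in fx) (iota 0 s1)
      & all (fun s => ((true, q * s + e.1), (true, q * s + e.2)) \in fx)
            (iota s1 (n0 - s1))])
    (iota 0 n0.+1).

(** The relation [Q] is abstract so that one test serves for arcs and for vertices. *)
Lemma family_okP (Q : nat -> nat -> Prop) t fx rn e n0 :
  {in fx, forall p, Q (at_ t p.1) (at_ t p.2)} ->
  {in rn, forall p s, s < t -> Q (q * s + p.1) (q * s + p.2)} ->
  family_ok fx rn e n0 -> forall s, s < n0 + t -> Q (q * s + e.1) (q * s + e.2).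
Proof.
move=> Qf Qr /hasP[s1]; rewrite mem_iota add0n => /andP[_ s1n].
move=> /and3P[Rs1 /allP L /allP R] s sn.
have [ss1|s1s] := ltnP s s1; first by apply: (Qf _ (L s _)); rewrite mem_iota.
have [ss1|ts] := ltnP s (s1 + t).
  have := Qr _ Rs1 (s - s1); rewrite /shift_arc /= !addnA -!mulnDr subnK //.
  by apply; lia.
have := Qf _ (R (s - t) _); rewrite /at_ /= !addnA -!mulnDr subnKC; last by lia.
by apply; rewrite mem_iota; lia.
Qed.
End Templates.

(** The indices i congruent to l modulo U form a family of step 4U; the quotient counts those below
    N. *)
Definition progression_ok (U : nat) fx rn (e : nat * nat) (N : nat) : bool :=
  all (fun l => family_ok (4 * U) fx rn (4 * l + e.1, 4 * l + e.2)
                  ((N + U - 1 - l) %/ U)) (iota 0 U).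

Lemma progression_okP (Q : nat -> nat -> Prop) U t fx rn e N : 0 < U ->
  {in fx, forall p, Q (at_ (4 * U) t p.1) (at_ (4 * U) t p.2)} ->
  {in rn, forall p s, s < t -> Q (4 * U * s + p.1) (4 * U * s + p.2)} ->
  progression_ok U fx rn e N ->
  forall i, i < N + U * t -> Q (4 * i + e.1) (4 * i + e.2).
Proof.
move=> U0 Qf Qr /allP ok i iN.
have lU := ltn_pmod i U0.
have iE := divn_eq i U.
have /(family_okP Qf Qr) H := ok (i %% U) ltac:(by rewrite mem_iota).
have E x : 4 * U * (i %/ U) + (4 * (i %% U) + x) = 4 * i + x.
  by rewrite addnA -mulnA -mulnDr [U * _]mulnC -iE.
rewrite -!E; apply: H.
have [st|ts] := ltnP (i %/ U) t; first by rewrite ltn_addl.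
rewrite -(subnKC ts) addnC ltn_add2r leq_divRL // mulSn mulnBl; nia.
Qed.

Definition cycle_template := (nat * seq item)%type.

Section CycleTemplates.
Variable q : nat.

Definition cyc (t : nat) (C : cycle_template) : seq nat := C.1 :: evs q t C.2.

(** Returning to the first vertex, which is never shifted, turns the cycle into a path. *)
Definition closing (C : cycle_template) : seq item := rcons C.2 (Fix false C.1).

Lemma cyc_arcs t (C : cycle_template) :
  dcycle_arcs (cyc t C) = pairs (at_ q t (false, C.1) :: evs q t (closing C)).
Proof.
by rewrite dcycle_arcs_cons /evs /closing map_rcons -!cats1 flatten_cat.
Qed.

Definition factor_template := seq cycle_template.

Definition fixed_arcs_of (TT : seq factor_template) :=
  flatten [seq fixed_arcs (false, C.1) (closing C) | C <- flatten TT].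

Definition run_arcs_of (TT : seq factor_template) :=
  flatten [seq run_arcs q (false, C.1) (closing C) | C <- flatten TT].

Definition wf_of (TT : seq factor_template) :=
  all (fun C => wf q (false, C.1) (closing C)) (flatten TT).

Lemma template_arcs_of t (TT : seq factor_template) : wf_of TT ->
  {in fixed_arcs_of TT, forall e,
     (at_ q t e.1, at_ q t e.2) \in arcs_of (map (map (cyc t)) TT)} /\
  {in run_arcs_of TT, forall e s, s < t ->
     (q * s + e.1, q * s + e.2) \in arcs_of (map (map (cyc t)) TT)}.
Proof.
move=> /allP wfT.
have inT C e : C \in flatten TT -> e \in dcycle_arcs (cyc t C) ->
    e \in arcs_of (map (map (cyc t)) TT).
  move=> CT eC; rewrite /arcs_of -map_flatten -map_comp.
  by apply/flatten_mapP; exists C.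
split=> e /flatten_mapP[C CT eC].
  apply: (inT C) => //; rewrite cyc_arcs.
  by have [H _] := template_arcs t (wfT C CT); apply: H.
move=> s st; apply: (inT C) => //; rewrite cyc_arcs.
by have [_ H] := template_arcs t (wfT C CT); apply: H.
Qed.
End CycleTemplates.

(** A vertex is treated as a loop, to which [progression_ok] applies. *)
Definition diag (T : Type) (x : T) := (x, x).

(** The first vertex [C.1] is left out of the count 2 k0. A period adds 2U vertices to each of the
    two cycles, 4U in all, which is the size of U levels. The four progressions are the lanes from
    level 1 on; the codes 2 and 3 are A and B. *)
Definition factor_ok (U k0 : nat) (TF : factor_template) : bool :=
  let fv := flatten [seq fixed_verts (Fix false C.1 :: C.2) | C <- TF] in
  let rv := flatten [seq run_verts C.2 | C <- TF] in
  [&& size TF == 2,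
      all (fun C => (size (fixed_verts C.2) == 2 * k0) && (size (run_verts C.2) == 2 * U)) TF,
      (false, 2) \in fv, (false, 3) \in fv
    & all (fun i => progression_ok U (map (@diag _) fv) (map (@diag _) rv)
                      (4 + i, 4 + i) k0) (iota 0 4)].

(** With k = k0 + U t, the two cycles have 4k+2 entries among which all 4k+2 codes occur, so each
    occurs once. *)
Lemma factor_okP U k0 t TF : 0 < U -> factor_ok U k0 TF ->
  all (fun c => size c == 2 * (k0 + U * t) + 1) (map (cyc (4 * U) t) TF) /\
  perm_eq (flatten (map (cyc (4 * U) t) TF)) (iota 2 (4 * (k0 + U * t) + 2)).
Proof.
move=> U0 /and5P[/eqP sz2 /allP szC f2 f3 /allP prog].
have szF : {in TF, forall C, size (cyc (4 * U) t C) = 2 * (k0 + U * t) + 1}.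
  by move=> C /szC/andP[/eqP sf /eqP sr]; rewrite /= size_evs sf sr; nia.
split; first by apply/allP => _ /mapP[C CT ->]; rewrite szF.
set W := flatten _.
have fixW : {in flatten [seq fixed_verts (Fix false C.1 :: C.2) | C <- TF],
    forall p, at_ (4 * U) t p \in W}.
  move=> p /flatten_mapP[C CT pC]; apply/flatten_mapP; exists C => //.
  by have [H _] := template_verts (4 * U) t (Fix false C.1 :: C.2); apply: H.
have runW : {in flatten [seq run_verts C.2 | C <- TF],
    forall x s, s < t -> 4 * U * s + x \in W}.
  move=> x /flatten_mapP[C CT xC] s st; apply/flatten_mapP; exists C => //.
  have [_ H] := template_verts (4 * U) t (Fix false C.1 :: C.2); exact: H.
have sub : {subset iota 2 (4 * (k0 + U * t) + 2) <= W}.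
  move=> v; rewrite mem_iota => /andP[v2 vk].
  have [v4|v4] := ltnP v 4.
    by have [->|->] : v = 2 \/ v = 3 by [lia]; [exact: fixW f2|exact: fixW f3].
  have iU : v %% 4 \in iota 0 4 by rewrite mem_iota ltn_pmod.
  have QF : {in map (@diag _) (flatten [seq fixed_verts (Fix false C.1 :: C.2) | C <- TF]),
      forall p, at_ (4 * U) t p.1 \in W}.
    by move=> _ /mapP[p pf ->]; apply: fixW.
  have QR : {in map (@diag _) (flatten [seq run_verts C.2 | C <- TF]),
      forall p s, s < t -> 4 * U * s + p.1 \in W}.
    by move=> _ /mapP[p pf ->] s; apply: runW.
  have := progression_okP (Q := fun u _ => u \in W) U0 QF QR (prog _ iU) (i := v %/ 4 - 1).
  by rewrite /= (_ : 4 * (v %/ 4 - 1) + (4 + v %% 4) = v); [apply; lia|lia].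
have szW : size W = 4 * (k0 + U * t) + 2.
  rewrite /W size_flatten /shape -map_comp (sumn_const_map (n := 2 * (k0 + U * t) + 1)) //.
    by rewrite sz2; lia.
have uI := iota_uniq 2 (4 * (k0 + U * t) + 2).
have szle : size W <= size (iota 2 (4 * (k0 + U * t) + 2)) by rewrite szW size_iota.
rewrite perm_sym; apply: uniq_perm => //; first exact: leq_size_uniq uI sub szle.
by case: (uniq_min_size uI sub szle).
Qed.

(** * Blocks *)

(** F begins with A, 0, 1 and B, 2k+1, 2k on level 1; each further level appends a word of two
    vertices to either cycle, hence period 4 and k - 1 copies. *)
Definition zigzag_template : factor_template :=
  [:: (2, [:: Fix false 5; Fix false 4; Up [:: 9; 8]]);
      (3, [:: Fix false 6; Fix false 7; Up [:: 10; 11]])].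

Definition zigzag (k : nat) : seq (seq nat) := map (cyc 4 k.-1) zigzag_template.

Lemma zigzag_factor k : 0 < k ->
  all (fun c => size c == 2 * k + 1) (zigzag k) /\
  perm_eq (flatten (zigzag k)) (iota 2 (4 * k + 2)).
Proof.
move=> k0; have := @factor_okP 1 1 k.-1 zigzag_template isT isT.
by rewrite mul1n add1n prednK.
Qed.

Lemma zig_zigzag k a b : 0 < k -> zig k a b -> (a, b) \in arcs_of [:: zigzag k].
Proof.
move=> k0.
have [Qf Qr] := @template_arcs_of 4 k.-1 [:: zigzag_template] isT.
rewrite -[map _ _]/[:: zigzag k] in Qf Qr.
pose Q u v := (u, v) \in arcs_of [:: zigzag k].
have prog := progression_okP (Q := Q) (isT : 0 < 1) Qf Qr.
have E u v u' v' : Q u v -> u = u' -> v = v' -> Q u' v' by move=> + <- <-.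
case=> [j jk|j jk|j jk|j jk||||].
(* Arcs within a level form progressions of length 1 + (k - 1), those between consecutive levels of
   length 0 + (k - 1); level j has index j - 1. *)
- by apply: (E _ _ _ _ (prog (5, 4) 1 isT (j - 1) _)) => /=; lia.
- by apply: (E _ _ _ _ (prog (4, 9) 0 isT (j - 1) _)) => /=; lia.
- by apply: (E _ _ _ _ (prog (6, 7) 1 isT (j - 1) _)) => /=; lia.
- by apply: (E _ _ _ _ (prog (7, 10) 0 isT (j - 1) _)) => /=; lia.
- by apply: (E _ _ _ _ (Qf ((true, 4), (false, 2)) isT)) => //; rewrite /at_ /=; lia.
- exact: (Qf ((false, 2), (false, 5)) isT).
- by apply: (E _ _ _ _ (Qf ((true, 7), (false, 3)) isT)) => //; rewrite /at_ /=; lia.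
- exact: (Qf ((false, 3), (false, 6)) isT).
Qed.

Definition rot_arc (k r : nat) (e : nat * nat) : nat * nat :=
  (rot_val k r (band_val k e.1), rot_val k r (band_val k e.2)).

(** Inclusions suffice: with only |R| + 1 factors, the count in [factorization_of_nat] leaves no
    room for repeated arcs. *)
Definition is_block (k : nat) (R : seq nat) (BB : seq (seq (seq nat))) : Prop :=
  [/\ all (is_nat_factor (4 * k + 2) (2 * k + 1)) BB,
      size BB = (size R).+1,
      uniq R && all (fun r => r < 4 * k) R,
      forall r a b, r \in R -> zig k a b -> rot_arc k r (a, b) \in arcs_of BB
    & forall u v, matched k u v -> (u, v) \in arcs_of BB].

(** The block replaces the rotations in R; its |R| + 1 factors and the other 4k - |R| rotations make
    4k + 1 factors on 4k + 2 vertices. *)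
Lemma block_factorization k R BB : 1 < k -> is_block k R BB ->
  exists FF : seq (seq (seq 'I_(4 * k + 2))), is_Cm_factorization (2 * k + 1) FF.
Proof.
move=> k1 [facB szB /andP[uR ltR] covR covM].
have k0 : 0 < k by lia.
pose rots := [seq r <- iota 0 (4 * k) | r \notin R].
pose rotz r := map (map (rot_val k r \o band_val k)) (zigzag k).
have zzr r : r \in rots -> rotz r \in BB ++ map rotz rots.
  by move=> rr; rewrite mem_cat map_f ?orbT.
apply: (@factorization_of_nat _ _ (BB ++ map rotz rots)); first by lia.
- rewrite all_cat facB; apply/allP => _ /mapP[r + ->].
  rewrite mem_filter mem_iota => /and3P[_ _ rk].
  by have [sz pe] := zigzag_factor k0; apply: band_factor.
- rewrite size_cat szB size_map.
  have := count_predC (mem R) (iota 0 (4 * k)); rewrite size_iota.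
  have -> : count (mem R) (iota 0 (4 * k)) = size R.
    rewrite -size_filter; apply: perm_size; apply: uniq_perm => //.
      by rewrite filter_uniq ?iota_uniq.
    move=> r; rewrite mem_filter mem_iota /=.
    by apply: andb_idr => rR; rewrite add0n (allP ltR).
  by rewrite /rots size_filter -[count (predC _) _]/(count (fun r => r \notin R) _); lia.
move=> u v uk vk uv; have [/covM uvB|] := zig_cover k1 uk vk uv.
  have /mem_arcs_of[F [c [FB Fc cuv]]] := uvB.
  by apply/mem_arcs_of; exists F, c; rewrite mem_cat FB.
move=> [r [a [b [rk ab <- <-]]]].
have [rR|rR] := boolP (r \in R).
  have /mem_arcs_of[F [c [FB Fc cuv]]] := covR _ _ _ rR ab.
  by apply/mem_arcs_of; exists F, c; rewrite mem_cat FB.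
have rr : r \in rots by rewrite mem_filter rR mem_iota.
have : rot_arc k r (a, b) \in arcs_of [:: rotz r].
  rewrite -[[:: rotz r]]/(map (map (map (rot_val k r \o band_val k))) [:: zigzag k]).
  rewrite arcs_of_map; apply/mapP; exists (a, b) => //; exact: zig_zigzag.
move=> /mem_arcs_of[F [c [+ Fc cuv]]]; rewrite inE => /eqP FE.
by apply/mem_arcs_of; exists F, c; rewrite FE zzr // -FE.
Qed.

(** A computable test for a single k. Here [BB] lists vertices by value, not by code. *)
Definition small_block_ok (k : nat) (R : seq nat) (BB : seq (seq (seq nat))) : bool :=
  let A := arcs_of BB in
  [&& all (is_nat_factor (4 * k + 2) (2 * k + 1)) BB,
      size BB == (size R).+1,
      uniq R && all (fun r => r < 4 * k) R,
      all (fun r => all (fun e => rot_arc k r e \in A) (arcs_of [:: zigzag k])) R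
    & [&& (4 * k, 4 * k + 1) \in A, (4 * k + 1, 4 * k) \in A
        & all (fun u => ((u, u + 2 * k) \in A) && ((u + 2 * k, u) \in A)) (iota 0 (2 * k))]].

Lemma small_blockP k R BB : 0 < k -> small_block_ok k R BB -> is_block k R BB.
Proof.
move=> k0 /and5P[facB /eqP szB ltR /allP covR /and3P[MAB MBA /allP M]]; split=> //.
  by move=> r a b /covR/allP cov /(zig_zigzag k0)/cov.
move=> u v [[uk ->]|[[vk ->]|[[-> ->]|[-> ->]]]] //.
  by have /andP[] := M u ltac:(by rewrite mem_iota).
by have /andP[] := M v ltac:(by rewrite mem_iota).
Qed.

(** * The rotations by 1, -1 and 2k in terms of levels and lanes *)

Ltac band_tac :=
  move=> *; rewrite ?band_val0 ?band_val1 ?band_val2 ?band_val3 ?band_valA ?band_valB;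
  try lia; repeat (case: eqP => ?); rewrite /rot_val; repeat (case: ifP => ?); lia.

Section RotBand.
Variable k : nat.
Hypothesis k2 : 2 < k.
Local Notation B := (band_val k).

Lemma rotA r : rot_val k r (B 2) = B 2.
Proof. by rewrite band_valA /rot_val ltnn. Qed.
Lemma rotB r : rot_val k r (B 3) = B 3.
Proof. by rewrite band_valB /rot_val; case: ifP; lia. Qed.

(** Rotation by 1 moves lanes 0 and 2 one level up and lanes 1 and 3 one level down. It changes lane
    from 0 to 3 and from 2 to 1 at level k, and from 1 to 0 and from 3 to 2 at level 1. *)
Lemma rot1_0 j : 0 < j < k -> rot_val k 1 (B (4 * j)) = B (4 * (j + 1)).
Proof. by band_tac. Qed.
Lemma rot1_0k : rot_val k 1 (B (4 * k)) = B (4 * k + 3).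
Proof. by band_tac. Qed.
Lemma rot1_1 j : 1 < j <= k -> rot_val k 1 (B (4 * j + 1)) = B (4 * (j - 1) + 1).
Proof. by band_tac. Qed.
Lemma rot1_11 : rot_val k 1 (B (4 * 1 + 1)) = B 4.
Proof. by rewrite -[4]/(4 * 1); band_tac. Qed.
Lemma rot1_2 j : 0 < j < k -> rot_val k 1 (B (4 * j + 2)) = B (4 * (j + 1) + 2).
Proof. by band_tac. Qed.
Lemma rot1_2k : rot_val k 1 (B (4 * k + 2)) = B (4 * k + 1).
Proof. by band_tac. Qed.
Lemma rot1_3 j : 1 < j <= k -> rot_val k 1 (B (4 * j + 3)) = B (4 * (j - 1) + 3).
Proof. by band_tac. Qed.
Lemma rot1_31 : rot_val k 1 (B (4 * 1 + 3)) = B (4 * 1 + 2).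
Proof. by band_tac. Qed.

(** Rotation by 4k - 1 undoes rotation by 1. *)
Lemma rotN_0 j : 1 < j <= k -> rot_val k (4 * k - 1) (B (4 * j)) = B (4 * (j - 1)).
Proof. by band_tac. Qed.
Lemma rotN_01 : rot_val k (4 * k - 1) (B (4 * 1)) = B (4 * 1 + 1).
Proof. by band_tac. Qed.
Lemma rotN_1 j : 0 < j < k -> rot_val k (4 * k - 1) (B (4 * j + 1)) = B (4 * (j + 1) + 1).
Proof. by band_tac. Qed.
Lemma rotN_1k : rot_val k (4 * k - 1) (B (4 * k + 1)) = B (4 * k + 2).
Proof. by band_tac. Qed.
Lemma rotN_2 j : 1 < j <= k -> rot_val k (4 * k - 1) (B (4 * j + 2)) = B (4 * (j - 1) + 2).
Proof. by band_tac. Qed.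
Lemma rotN_21 : rot_val k (4 * k - 1) (B (4 * 1 + 2)) = B (4 * 1 + 3).
Proof. by band_tac. Qed.
Lemma rotN_3 j : 0 < j < k -> rot_val k (4 * k - 1) (B (4 * j + 3)) = B (4 * (j + 1) + 3).
Proof. by band_tac. Qed.
Lemma rotN_3k : rot_val k (4 * k - 1) (B (4 * k + 3)) = B (4 * k).
Proof. by band_tac. Qed.

(** Rotation by 2k keeps levels and exchanges lanes 0 and 2, and lanes 1 and 3. *)
Lemma rotH_0 j : 0 < j <= k -> rot_val k (2 * k) (B (4 * j)) = B (4 * j + 2).
Proof. by band_tac. Qed.
Lemma rotH_1 j : 0 < j <= k -> rot_val k (2 * k) (B (4 * j + 1)) = B (4 * j + 3).
Proof. by band_tac. Qed.
Lemma rotH_2 j : 0 < j <= k -> rot_val k (2 * k) (B (4 * j + 2)) = B (4 * j).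
Proof. by band_tac. Qed.
Lemma rotH_3 j : 0 < j <= k -> rot_val k (2 * k) (B (4 * j + 3)) = B (4 * j + 1).
Proof. by band_tac. Qed.
End RotBand.

(** * Blocks from periodic templates *)

(* Arcs between levels away from both ends: the pair (e, N) stands for the arcs e + 4i
   with i < N.  The rows come from the rotations 0, 2k, 1, -1 of F and from the arcs
   x <-> x + 2k. *)
Definition progressions (k0 : nat) : seq ((nat * nat) * nat) :=
  [:: ((5, 4), k0); ((4, 9), k0 - 1); ((6, 7), k0); ((7, 10), k0 - 1);
      ((7, 6), k0); ((6, 11), k0 - 1); ((4, 5), k0); ((5, 8), k0 - 1);
      ((5, 12), k0 - 2); ((8, 5), k0 - 1); ((14, 7), k0 - 2); ((7, 18), k0 - 3);
      ((13, 4), k0 - 2); ((4, 17), k0 - 3); ((6, 15), k0 - 2); ((11, 6), k0 - 1);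
      ((4, 6), k0); ((6, 4), k0); ((5, 7), k0); ((7, 5), k0)].

(* The remaining arcs; R i t is lane t of the level k - i. *)
Definition boundary_arcs (k0 : nat) : seq ((bool * nat) * (bool * nat)) :=
  let L n := (false, n) in
  let R i t := (true, 4 * (k0 - i) + t) in
  [:: (R 0 0, L 2); (L 2, L 5); (R 0 3, L 3); (L 3, L 6);
      (R 0 2, L 2); (L 2, L 7); (R 0 1, L 3); (L 3, L 4);
      (L 4, L 8); (R 1 1, R 0 3); (L 10, L 6); (R 0 1, R 1 3); (L 6, L 14); (R 2 3, R 0 1);
      (R 0 3, L 2); (L 2, L 4); (R 1 3, L 3); (L 3, L 10);
      (L 9, L 5); (R 0 2, R 1 0); (L 5, L 13); (R 2 0, R 0 2); (L 7, L 11); (R 1 2, R 0 0);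
      (R 1 0, L 2); (L 2, L 9); (R 0 0, L 3); (L 3, L 7);
      (L 2, L 3); (L 3, L 2)].

(** A finite test free of t: five factors, one more than the four rotations, with a period of two
    levels, that is 8 codes. *)
Definition band_block_ok (k0 : nat) (BT : seq factor_template) : bool :=
  [&& 2 < k0, size BT == 5, all (factor_ok 2 k0) BT, wf_of 8 BT
    & all (fun c => progression_ok 2 (fixed_arcs_of BT) (run_arcs_of 8 BT) c.1 c.2)
          (progressions k0) &&
      all (fun e => e \in fixed_arcs_of BT) (boundary_arcs k0)].

Ltac progression P e N i :=
  apply: (P e N ltac:(by rewrite !inE eqxx ?orbT) i) => /=; lia.
Ltac boundary Bd x y :=
  apply: (Bd (x, y) ltac:(by rewrite !inE eqxx ?orbT)); rewrite /at_ /=; lia.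

(** Each required arc lies in a progression or is a boundary arc, and the test on templates
    certifies both kinds for every t. *)
Lemma band_blockP k0 t BT : band_block_ok k0 BT ->
  exists R BB, is_block (k0 + 2 * t) R BB.
Proof.
move=> /and5P[k02 /eqP szBT /allP facBT wfBT /andP[/allP prog /allP bnd]].
have [k kE] : exists k, k = k0 + 2 * t by exists (k0 + 2 * t).
have k2 : 2 < k by lia.
rewrite -kE.
pose BB0 := map (map (cyc 8 t)) BT.
pose BB := map (map (map (band_val k))) BB0.
exists [:: 0; 1; 2 * k; 4 * k - 1], BB.
have [Qf Qr] := @template_arcs_of 8 t BT wfBT.
rewrite -/BB0 in Qf Qr.
pose Q u v := (u, v) \in arcs_of BB0.
have inB u v : Q u v -> (band_val k u, band_val k v) \in arcs_of BB.
  by move=> uv; rewrite arcs_of_map; apply/mapP; exists (u, v).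
have P e N : (e, N) \in progressions k0 ->
    forall i u v, i < N + 2 * t -> 4 * i + e.1 = u -> 4 * i + e.2 = v -> Q u v.
  move=> eN i u v iN <- <-.
  exact: (progression_okP (Q := Q) (isT : 0 < 2) Qf Qr (prog _ eN)).
have Bd e : e \in boundary_arcs k0 ->
    forall u v, at_ 8 t e.1 = u -> at_ 8 t e.2 = v -> Q u v.
  by move=> /bnd eB u v <- <-; apply: Qf.
split.
(* This brings the factors into the form of [band_factor], with rotation by 0. *)
- have rB F : map (map (band_val k)) F = map (map (rot_val k 0 \o band_val k)) F.
    by apply: eq_map => s; apply: eq_map => x /=; rewrite rot_val0.
  apply/allP => _ /mapP[_ /mapP[TF TB ->] ->]; rewrite rB.
  have [szF pF] := @factor_okP 2 k0 t TF isT (facBT _ TB).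
  by rewrite -kE in szF pF; apply: band_factor => //; lia.
- by rewrite !size_map szBT.
- by rewrite /= !inE; lia.
- move=> r x y; rewrite !inE => /or4P[] /eqP-> z; rewrite /rot_arc /=.
  + rewrite !rot_val0; apply: inB; case: z => [j jk|j jk|j jk|j jk||||].
    * by progression P (5, 4) k0 (j - 1).
    * by progression P (4, 9) (k0 - 1) (j - 1).
    * by progression P (6, 7) k0 (j - 1).
    * by progression P (7, 10) (k0 - 1) (j - 1).
    (* The term [4 * (k0 - 0) + 0] is [R 0 0] of [boundary_arcs]; shifting it by t periods gives
       lane 0 of level k. *)
    * by boundary Bd (true, 4 * (k0 - 0) + 0) (false, 2).
    * by boundary Bd (false, 2) (false, 5).
    * by boundary Bd (true, 4 * (k0 - 0) + 3) (false, 3).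
    * by boundary Bd (false, 3) (false, 6).
  (* Rotation by 1. An end that changes lane at level 1 or k gives a boundary arc; where j = 1 is
     split off for this reason, the progression starts at j = 2 and the index is j - 2. *)
  + case: z => [j jk|j jk|j jk|j jk||||].
    * have [->|j1] := eqVneq j 1.
        rewrite (rot1_11 k2) -[4]/(4 * 1) (rot1_0 k2); last lia.
        by apply: inB; boundary Bd (false, 4) (false, 8).
      have [->|jk'] := eqVneq j k.
        rewrite (rot1_1 k2) ?(rot1_0k k2); last lia.
        by apply: inB; boundary Bd (true, 4 * (k0 - 1) + 1) (true, 4 * (k0 - 0) + 3).
      rewrite (rot1_1 k2) ?(rot1_0 k2); try lia.
      by apply: inB; progression P (5, 12) (k0 - 2) (j - 2).
    * rewrite (rot1_0 k2) ?(rot1_1 k2); try lia.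
      by apply: inB; progression P (8, 5) (k0 - 1) (j - 1).
    * have [->|j1] := eqVneq j 1.
        rewrite (rot1_31 k2) (rot1_2 k2); last lia.
        by apply: inB; boundary Bd (false, 10) (false, 6).
      have [->|jk'] := eqVneq j k.
        rewrite (rot1_2k k2) (rot1_3 k2); last lia.
        by apply: inB; boundary Bd (true, 4 * (k0 - 0) + 1) (true, 4 * (k0 - 1) + 3).
      rewrite (rot1_2 k2) ?(rot1_3 k2); try lia.
      by apply: inB; progression P (14, 7) (k0 - 2) (j - 2).
    * have [->|j1] := eqVneq j 1.
        rewrite (rot1_31 k2) (rot1_2 k2); last lia.
        by apply: inB; boundary Bd (false, 6) (false, 14).
      have [jE|jk'] := eqVneq (j + 1) k.
        rewrite jE (rot1_2k k2) (rot1_3 k2); last lia.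
        by apply: inB; boundary Bd (true, 4 * (k0 - 2) + 3) (true, 4 * (k0 - 0) + 1).
      rewrite (rot1_3 k2) ?(rot1_2 k2); try lia.
      by apply: inB; progression P (7, 18) (k0 - 3) (j - 2).
    * rewrite (rot1_0k k2) rotA; apply: inB.
      by boundary Bd (true, 4 * (k0 - 0) + 3) (false, 2).
    * rewrite rotA -[5]/(4 * 1 + 1) (rot1_11 k2); apply: inB.
      by boundary Bd (false, 2) (false, 4).
    * rewrite (rotB k2) (rot1_3 k2); last lia.
      by apply: inB; boundary Bd (true, 4 * (k0 - 1) + 3) (false, 3).
    * rewrite (rotB k2) -[6]/(4 * 1 + 2) (rot1_2 k2); last lia.
      by apply: inB; boundary Bd (false, 3) (false, 10).
  (* Rotation by 2k: levels are kept, so no case at the ends is split off. *)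
  + case: z => [j jk|j jk|j jk|j jk||||].
    * rewrite (rotH_0 k2) ?(rotH_1 k2); try lia.
      by apply: inB; progression P (7, 6) k0 (j - 1).
    * rewrite (rotH_0 k2) ?(rotH_1 k2); try lia.
      by apply: inB; progression P (6, 11) (k0 - 1) (j - 1).
    * rewrite (rotH_2 k2) ?(rotH_3 k2); try lia.
      by apply: inB; progression P (4, 5) k0 (j - 1).
    * rewrite (rotH_3 k2) ?(rotH_2 k2); try lia.
      by apply: inB; progression P (5, 8) (k0 - 1) (j - 1).
    * rewrite rotA (rotH_0 k2); last lia.
      by apply: inB; boundary Bd (true, 4 * (k0 - 0) + 2) (false, 2).
    * rewrite rotA -[5]/(4 * 1 + 1) (rotH_1 k2); last lia.
      by apply: inB; boundary Bd (false, 2) (false, 7).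
    * rewrite (rotB k2) (rotH_3 k2); last lia.
      by apply: inB; boundary Bd (true, 4 * (k0 - 0) + 1) (false, 3).
    * rewrite (rotB k2) -[6]/(4 * 1 + 2) (rotH_2 k2); last lia.
      by apply: inB; boundary Bd (false, 3) (false, 4).
  (* Rotation by -1: as for 1, with the lanes moving the other way. *)
  + case: z => [j jk|j jk|j jk|j jk||||].
    * have [->|j1] := eqVneq j 1.
        rewrite (rotN_01 k2) (rotN_1 k2); last lia.
        by apply: inB; boundary Bd (false, 9) (false, 5).
      have [->|jk'] := eqVneq j k.
        rewrite (rotN_1k k2) (rotN_0 k2); last lia.
        by apply: inB; boundary Bd (true, 4 * (k0 - 0) + 2) (true, 4 * (k0 - 1) + 0).
      rewrite (rotN_1 k2) ?(rotN_0 k2); try lia.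
      by apply: inB; progression P (13, 4) (k0 - 2) (j - 2).
    * have [->|j1] := eqVneq j 1.
        rewrite (rotN_01 k2) (rotN_1 k2); last lia.
        by apply: inB; boundary Bd (false, 5) (false, 13).
      have [jE|jk'] := eqVneq (j + 1) k.
        rewrite jE (rotN_1k k2) (rotN_0 k2); last lia.
        by apply: inB; boundary Bd (true, 4 * (k0 - 2) + 0) (true, 4 * (k0 - 0) + 2).
      rewrite (rotN_0 k2) ?(rotN_1 k2); try lia.
      by apply: inB; progression P (4, 17) (k0 - 3) (j - 2).
    * have [->|j1] := eqVneq j 1.
        rewrite (rotN_21 k2) (rotN_3 k2); last lia.
        by apply: inB; boundary Bd (false, 7) (false, 11).
      have [->|jk'] := eqVneq j k.
        rewrite (rotN_3k k2) (rotN_2 k2); last lia.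
        by apply: inB; boundary Bd (true, 4 * (k0 - 1) + 2) (true, 4 * (k0 - 0) + 0).
      rewrite (rotN_2 k2) ?(rotN_3 k2); try lia.
      by apply: inB; progression P (6, 15) (k0 - 2) (j - 2).
    * rewrite (rotN_3 k2) ?(rotN_2 k2); try lia.
      by apply: inB; progression P (11, 6) (k0 - 1) (j - 1).
    * rewrite rotA (rotN_0 k2); last lia.
      by apply: inB; boundary Bd (true, 4 * (k0 - 1) + 0) (false, 2).
    * rewrite rotA -[5]/(4 * 1 + 1) (rotN_1 k2); last lia.
      by apply: inB; boundary Bd (false, 2) (false, 9).
    * rewrite (rotB k2) (rotN_3k k2); apply: inB.
      by boundary Bd (true, 4 * (k0 - 0) + 0) (false, 3).
    * rewrite (rotB k2) -[6]/(4 * 1 + 2) (rotN_21 k2); apply: inB.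
      by boundary Bd (false, 3) (false, 7).
(* The residues u and u + 2k share a level. Below 2k, u = 0 is in lane 1 of level 1, 1..k are lane
   0, and k < u is in lane 3 of level 2k+1-u. *)
- have M u : u < 2 * k ->
      exists x y, [/\ Q x y, Q y x, band_val k x = u & band_val k y = u + 2 * k].
    move=> uk; have [->|u0] := eqVneq u 0.
      exists (4 * 1 + 1), (4 * 1 + 3); rewrite band_val1 // band_val3 //=.
      by split; [progression P (5, 7) k0 0|progression P (7, 5) k0 0|lia|lia].
    have [ku|ku] := leqP u k.
      exists (4 * u), (4 * u + 2); rewrite band_val0 ?band_val2; try lia.
      by split=> //; [progression P (4, 6) k0 (u - 1)|progression P (6, 4) k0 (u - 1)].
    exists (4 * (2 * k + 1 - u) + 3), (4 * (2 * k + 1 - u) + 1).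
    rewrite band_val3 ?band_val1; try lia.
    split; [progression P (7, 5) k0 (2 * k - u)|progression P (5, 7) k0 (2 * k - u)|lia|].
    by case: eqP; lia.
  move=> u v [[/M[x [y [xy _ <- <-]]] ->]|[[/M[x [y [_ yx <- <-]]] ->]|[[-> ->]|[-> ->]]]].
  + exact: inB.
  + exact: inB.
  + by rewrite -(band_valB k) -(band_valA k); apply: inB; boundary Bd (false, 2) (false, 3).
  + by rewrite -(band_valB k) -(band_valA k); apply: inB; boundary Bd (false, 3) (false, 2).
Qed.

(** * Explicit templates and blocks *)

Definition lefts : seq nat -> seq item := map (Fix false).
Definition rights : seq nat -> seq item := map (Fix true).

(** At t = 0 the runs vanish and 2 * 8 + 1 vertices per cycle remain. In the second and fourth
    factors one cycle ascends by four vertices per period, while the other goes up and comes back by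
    two each way. *)
Definition templates8 : seq factor_template :=
  [::
   [:: (5, lefts [:: 7; 10; 8; 13; 15; 18; 16; 21] ++ Up [:: 23; 26; 24; 29] :: rights
      [:: 24; 29; 31; 30; 32; 34] ++ lefts [:: 2; 4]);
      (11, lefts [:: 9; 12; 14; 19; 17; 20; 22] ++ Up [:: 27; 25; 28; 30] :: rights [::
      23; 26; 27; 25; 28; 33; 35] ++ lefts [:: 3; 6])];
   [:: (5, lefts [:: 13; 4; 8; 21; 12; 9; 16; 29] ++ Up [:: 20; 17; 24; 37] :: rights
      [:: 28; 30; 35; 34; 32] ++ lefts [:: 3; 2; 7]);
      (6, lefts [:: 15; 14; 23; 22] ++ Up [:: 31; 30] :: rights [:: 20; 17; 24; 25; 27;
      33; 31; 26; 19; 18; 11; 10] ++ [:: Down [:: 11; 10]])];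
   [:: (8, lefts [:: 5; 4; 17; 16; 13; 12; 25] ++ Up [:: 24; 21; 20; 33] :: rights [::
      32; 29; 20; 33; 24; 21; 28] ++ lefts [:: 2; 9]);
      (11, lefts [:: 6; 7; 18; 19; 14; 15; 26] ++ Up [:: 27; 22; 23; 34] :: rights [::
      35; 30; 23; 34; 27; 22; 31] ++ lefts [:: 3; 10])];
   [:: (6, lefts [:: 14; 7; 11; 22; 15; 10; 19; 30] ++ Up [:: 23; 18; 27; 38] :: rights
      [:: 31; 29; 35; 33; 32] ++ lefts [:: 2; 3; 4]);
      (5, lefts [:: 12; 13; 20; 21] ++ Up [:: 28; 29] :: rights [:: 23; 18; 27; 26; 24;
      34; 28; 25; 16; 17; 8; 9] ++ [:: Down [:: 8; 9]])];
   [:: (8, lefts [:: 10; 15; 13; 16; 18; 23; 21] ++ Up [:: 24; 26; 31; 29] :: rights [::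
      20; 25; 24; 26; 31; 34; 35] ++ lefts [:: 2; 5]);
      (6, lefts [:: 4; 9; 11; 14; 12; 17; 19; 22] ++ Up [:: 20; 25; 27; 30] :: rights
      [:: 27; 30; 28; 29; 32; 33] ++ lefts [:: 3; 7])]].

Definition templates9 : seq factor_template :=
  [::
   [:: (5, lefts [:: 8; 13; 4; 9; 16; 21; 12; 17; 24] ++ Up [:: 29; 20; 25; 32] ::
      rights [:: 37; 28; 33; 35; 34; 36] ++ lefts [:: 3; 2; 7]);
      (6, lefts [:: 15; 14; 23; 22; 31; 30; 39; 38] ++ Up [:: 47; 46] :: rights [:: 32;
      29; 20; 25; 27; 26; 19; 18; 11; 10] ++ [:: Down [:: 11; 10]])];
   [:: (12, lefts [:: 14; 19; 17; 20; 22; 27; 25] ++ Up [:: 28; 30; 35; 33] :: rights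
      [:: 24; 26; 35; 30; 28; 38; 36; 33; 32] ++ lefts [:: 2; 9]);
      (11, lefts [:: 6; 4; 5; 13; 15; 10; 8; 21; 23; 18; 16; 29; 31] ++ Up [:: 26; 24;
      37; 39] :: rights [:: 34; 39; 37] ++ lefts [:: 3; 7])];
   [:: (4, lefts [:: 17; 16; 13; 12; 25] ++ Up [:: 24; 21; 20; 33] :: rights [:: 28; 30;
      23; 34; 32; 37; 35; 38; 31; 29; 36] ++ lefts [:: 2; 5]);
      (11, lefts [:: 9; 8; 10; 19; 14; 7; 18; 27; 22; 15; 26] ++ Up [:: 35; 30; 23; 34]
      :: rights [:: 24; 21; 20; 33; 39] ++ lefts [:: 3; 6])];
   [:: (6, lefts [:: 7; 10; 11; 14; 15; 18; 19; 22; 23; 26] ++ Up [:: 27; 30; 31; 34] ::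
      rights [:: 31; 37; 36; 38; 39] ++ lefts [:: 2; 3; 4]);
      (5, lefts [:: 12; 13; 20; 21; 28; 29] ++ Up [:: 36; 37] :: rights [:: 32; 34; 27;
      30; 35; 33; 24; 25; 16; 17; 8; 9] ++ [:: Down [:: 8; 9]])];
   [:: (8, lefts [:: 5; 7; 6; 14; 12; 9; 11; 22; 20; 17; 19; 30] ++ Up [:: 28; 25; 27;
      38] :: rights [:: 31; 26; 27; 38] ++ lefts [:: 2; 4]);
      (15, lefts [:: 13; 16; 18; 23; 21; 24] ++ Up [:: 26; 31; 29; 32] :: rights [::
      29; 28; 25; 32; 33; 36; 37; 39; 34; 35] ++ lefts [:: 3; 10])]].

(** From here on vertices are given by value, so that A is 4k and B is 4k+1. *)
Definition block2 : seq (seq (seq nat)) :=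
  [::
   [:: [:: 8; 9; 5; 7; 2];
       [:: 0; 1; 6; 3; 4]];
   [:: [:: 8; 0; 5; 4; 9];
       [:: 1; 7; 6; 2; 3]];
   [:: [:: 8; 2; 5; 1; 4];
       [:: 9; 6; 0; 7; 3]];
   [:: [:: 8; 1; 2; 0; 3];
       [:: 9; 7; 4; 6; 5]];
   [:: [:: 8; 3; 7; 1; 5];
       [:: 9; 0; 4; 2; 6]]].

Definition block3 : seq (seq (seq nat)) :=
  [::
   [:: [:: 12; 0; 1; 7; 13; 10; 4];
       [:: 11; 2; 3; 9; 6; 8; 5]];
   [:: [:: 12; 2; 5; 1; 11; 6; 13];
       [:: 0; 3; 4; 10; 7; 9; 8]];
   [:: [:: 12; 1; 2; 0; 6; 10; 3];
       [:: 13; 8; 7; 11; 5; 9; 4]];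
   [:: [:: 12; 13; 7; 1; 6; 0; 5];
       [:: 10; 9; 3; 11; 4; 2; 8]];
   [:: [:: 12; 3; 1; 4; 0; 7; 6];
       [:: 13; 9; 11; 8; 2; 10; 5]]].

Definition block4 : seq (seq (seq nat)) :=
  [::
   [:: [:: 16; 0; 7; 13; 10; 9; 15; 8; 17];
       [:: 1; 6; 12; 11; 3; 4; 2; 14; 5]];
   [:: [:: 16; 17; 12; 4; 14; 9; 1; 15; 7];
       [:: 0; 3; 11; 8; 10; 2; 5; 13; 6]];
   [:: [:: 16; 1; 9; 11; 6; 14; 3; 13; 4];
       [:: 17; 10; 7; 15; 2; 0; 8; 12; 5]];
   [:: [:: 16; 3; 15; 4; 12; 7; 11; 13; 5];
       [:: 17; 9; 8; 0; 1; 2; 10; 14; 6]]].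

Definition block5 : seq (seq (seq nat)) :=
  [::
   [:: [:: 20; 21; 11; 1; 2; 18; 8; 16; 7; 17; 6];
       [:: 0; 5; 15; 10; 12; 14; 9; 13; 3; 19; 4]];
   [:: [:: 20; 0; 10; 14; 11; 13; 12; 9; 17; 8; 21];
       [:: 1; 4; 18; 7; 15; 6; 16; 5; 19; 2; 3]];
   [:: [:: 20; 1; 11; 15; 8; 18; 5; 17; 4; 14; 7];
       [:: 21; 12; 2; 0; 3; 13; 10; 16; 9; 19; 6]];
   [:: [:: 20; 2; 12; 11; 10; 0; 1; 19; 9; 15; 5];
       [:: 21; 13; 8; 14; 4; 16; 6; 18; 3; 17; 7]]].

Definition block6 : seq (seq (seq nat)) :=
  [::
   [:: [:: 24; 25; 13; 1; 4; 20; 5; 19; 8; 18; 7; 21; 6];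
       [:: 0; 3; 23; 11; 15; 14; 2; 22; 10; 16; 9; 17; 12]];
   [:: [:: 24; 2; 3; 15; 12; 14; 16; 11; 23; 6; 18; 9; 25];
       [:: 0; 1; 13; 17; 8; 20; 7; 19; 10; 22; 5; 21; 4]];
   [:: [:: 24; 0; 5; 17; 10; 18; 11; 19; 6; 20; 9; 21; 8];
       [:: 25; 15; 3; 1; 23; 2; 14; 13; 12; 16; 4; 22; 7]];
   [:: [:: 24; 1; 2; 0; 12; 18; 6; 22; 3; 21; 9; 19; 7];
       [:: 25; 14; 11; 17; 5; 23; 4; 16; 13; 15; 10; 20; 8]]].

Definition block7 : seq (seq (seq nat)) :=
  [::
   [:: [:: 28; 29; 15; 1; 3; 25; 8; 24; 5; 27; 2; 26; 6; 22; 7];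
       [:: 0; 4; 18; 11; 23; 9; 21; 12; 19; 10; 20; 13; 17; 16; 14]];
   [:: [:: 28; 0; 1; 4; 24; 10; 21; 7; 25; 11; 20; 9; 22; 8; 29];
       [:: 12; 18; 15; 19; 14; 16; 2; 3; 17; 13; 27; 5; 23; 6; 26]];
   [:: [:: 28; 15; 14; 17; 12; 26; 3; 1; 27; 6; 20; 10; 24; 8; 22];
       [:: 29; 2; 16; 13; 18; 4; 0; 5; 19; 11; 25; 7; 21; 9; 23]];
   [:: [:: 28; 2; 1; 15; 16; 18; 12; 22; 11; 19; 5; 26; 7; 24; 9];
       [:: 29; 17; 3; 0; 14; 20; 6; 25; 4; 27; 13; 21; 8; 23; 10]]].

(** * Existence of blocks and the factorization *)

Lemma blocks k : 1 < k -> exists R BB, is_block k R BB.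
Proof.
move=> k1; have [k8|] := leqP 8 k.
  (* The period is two levels, so the parity of k decides between the two templates. *)
  have [t [kE|kE]] : exists t, k = 8 + 2 * t \/ k = 9 + 2 * t by exists ((k - 8) %/ 2); lia.
    by rewrite kE; apply: (@band_blockP _ _ templates8); vm_compute.
  by rewrite kE; apply: (@band_blockP _ _ templates9); vm_compute.
case: k k1 => [|[|[|[|[|[|[|[|//]]]]]]]] // _ _.
- by exists [:: 0; 1; 2; 3], block2; apply: small_blockP; vm_compute.
- by exists [:: 0; 1; 2; 3], block3; apply: small_blockP; vm_compute.
- by exists [:: 0; 1; 3], block4; apply: small_blockP; vm_compute.
- by exists [:: 0; 1; 2], block5; apply: small_blockP; vm_compute.
- by exists [:: 0; 1; 2], block6; apply: small_blockP; vm_compute.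
- by exists [:: 0; 2; 15], block7; apply: small_blockP; vm_compute.
Qed.

Theorem theorem3 (m : nat) : odd m -> 5 <= m ->
  exists FF : seq (seq (seq 'I_(2 * m))), is_Cm_factorization m FF.
Proof.
move=> m_odd m5.
have [k mE] : exists k, m = 2 * k + 1 by exists (m./2); lia.
have k1 : 1 < k by lia.
have [R [BB blk]] := blocks k1.
have -> : 2 * m = 4 * k + 2 by lia.
by rewrite mE; apply: block_factorization k1 blk.
Qed.
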